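(* For each braid $b$ in $B_3^+$, the $\mathcal{G}_3$-sequence from $b$ is finite, i.e., there exists a natural number $t$ such that the sequence reaches the trivial braid $1$ after $t$ steps: $b\{1\}\{2\}\cdots\{t\}=1$.
   Context: $B_3^+$ is the monoid of positive $3$-strand braids, with monoid presentation $\langle\sigma_1,\sigma_2 \mid \sigma_1\sigma_2\sigma_1=\sigma_2\sigma_1\sigma_2\rangle$; $1$ is the trivial braid. Normal words. Put $[k]=1$ for $k$ odd and $[k]=2$ for $k$ even. Every nonempty word $w$ in the letters $\sigma_1,\sigma_2$ can be written $\sigma_{[p]}^{e_p}\cdots\sigma_1^{e_3}\sigma_2^{e_2}\sigma_1^{e_1}$ with $e_k\ge 0$; the unique such expression with $p$ minimal is the block decomposition of $w$, and $\sigma_{[k]}^{e_k}$ is its $k$th block (blocks are numbered from the right; block $1$ may be empty). Put $e^{\min}_1=0$, $e^{\min}_2=1$ and $e^{\min}_k=2$ for $k\ge3$. The word $w$ is called $\phi$-normal if its block decomposition satisfies $e_k\ge e^{\min}_k$ for all $k<p$. Known fact: every nontrivial braid in $B_3^+$ is represented by a unique $\phi$-normal word. The sequence $(e_p,\dots,e_1)$ associated with this word is called the exponent sequence of the braid, and $p$ its breadth. Critical position. For $b\ne1$ in $B_3^+$ with exponent sequence $(e_p,\dots,e_1)$, the critical position of $b$ is the least $r<p$ with $e_r>e^{\min}_r$ if such an $r$ exists, and $p$ otherwise. Operation. For $b\neq 1$ in $B_3^+$ and $t\in\mathbb{N}$, let $w$ be the $\phi$-normal word representing $b$ and $r$ the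 critical position of $b$. Let $w\{t\}$ be the word obtained from $w$ by removing one letter from the $r$th block and, if $r\ge2$, adding $t$ letters to the $(r-1)$st block (i.e. $e_r$ is replaced with $e_r-1$ and, if $r\ge 2$, $e_{r-1}$ with $e_{r-1}+t$). Then $b\{t\}$ is the braid represented by $w\{t\}$. $\mathcal{G}_3$-sequence. The $\mathcal{G}_3$-sequence from $b$ is $(b_0,b_1,\dots)$ with $b_0=b$ and $b_t=b_{t-1}\{t\}$ for $t\ge1$; it stops when the trivial braid $1$ is obtained. *)

(* Defs.v *)
From Stdlib Require Import Relation_Operators.
From HB Require Import structures.
From mathcomp Require Import all_boot.
From mathcomp Require Import boolp classical_sets.

Set Implicit Arguments.
Unset Strict Implicit.
Unset Printing Implicit Defensive.

Local Open Scope quotient_scope.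

(* sigma k is $\sigma_{[k]}$: the letter true stands for $\sigma_1$ and false
   for $\sigma_2$. *)
Definition letter : Type := bool.
Definition sigma (k : nat) : letter := odd k.

Definition word : Type := seq letter.

Inductive braid_step : word -> word -> Prop :=
  BraidStep (u v : word) :
    braid_step (u ++ [:: sigma 1; sigma 2; sigma 1] ++ v)
               (u ++ [:: sigma 2; sigma 1; sigma 2] ++ v).

Definition braid_eqv : word -> word -> Prop := clos_refl_sym_trans word braid_step.

Lemma braid_eqv_cat (u u' v v' : word) :
  braid_eqv u u' -> braid_eqv v v' -> braid_eqv (u ++ v) (u' ++ v').
Proof.
move=> uu' vv'; apply: (@rst_trans _ _ _ (u' ++ v)).
  elim: uu' => {u u'} [_ _ [x y]|u|u u' _ IH|a b c _ IHab _ IHbc].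
  - by rewrite -!catA; apply: rst_step; apply: BraidStep.
  - exact: rst_refl.
  - exact: rst_sym.
  - exact: rst_trans IHab IHbc.
elim: vv' => {v v'} [_ _ [x y]|v|v v' _ IH|a b c _ IHab _ IHbc].
- by rewrite [u' ++ (_ ++ _)]catA [u' ++ (x ++ [:: sigma 2; _; _] ++ y)]catA;
    apply: rst_step; apply: BraidStep.
- exact: rst_refl.
- exact: rst_sym.
- exact: rst_trans IHab IHbc.
Qed.

Definition braid_eqvb : rel word := fun u v => `[< braid_eqv u v >].

Lemma braid_eqvb_refl : reflexive braid_eqvb.
Proof. by move=> u; apply/asboolP; apply: rst_refl. Qed.

Lemma braid_eqvb_sym : symmetric braid_eqvb.
Proof. by move=> u v; apply/asboolP/asboolP; apply: rst_sym. Qed.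

Lemma braid_eqvb_trans : transitive braid_eqvb.
Proof.
move=> v u w /asboolP uv /asboolP vw; apply/asboolP.
exact: rst_trans uv vw.
Qed.

Canonical braid_equiv_rel :=
  EquivRel braid_eqvb braid_eqvb_refl braid_eqvb_sym braid_eqvb_trans.

Definition B3plus : Type := {eq_quot braid_eqvb}.
HB.instance Definition _ := Choice.on B3plus.
HB.instance Definition _ := EqQuotient.on B3plus.

Definition braid (w : word) : B3plus := \pi_B3plus w.

Lemma braidP (u v : word) : braid u = braid v <-> braid_eqv u v.
Proof.
split=> [/eqP|uv]; first by rewrite /braid eqmodE => /asboolP.
by apply/eqP; rewrite /braid eqmodE; apply/asboolP.
Qed.

Lemma braid_surj (b : B3plus) : braid (repr b) = b.
Proof. exact: reprK. Qed.

Definition braid_one : B3plus := braid [::].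
Definition braid_mul (a b : B3plus) : B3plus := braid (repr a ++ repr b).

Lemma braid_mulE (u v : word) : braid_mul (braid u) (braid v) = braid (u ++ v).
Proof.
by apply/braidP; apply: braid_eqv_cat; apply/braidP; apply: braid_surj.
Qed.

Lemma braid_mulA : associative braid_mul.
Proof.
move=> a b c; rewrite -(braid_surj a) -(braid_surj b) -(braid_surj c).
by rewrite !braid_mulE catA.
Qed.

Lemma braid_mul1 : left_id braid_one braid_mul.
Proof. by move=> a; rewrite -(braid_surj a) braid_mulE. Qed.

Lemma braid_mulr1 : right_id braid_one braid_mul.
Proof. by move=> a; rewrite -(braid_surj a) braid_mulE cats0. Qed.

HB.instance Definition _ :=
  isMonoid.Build B3plus braid_mulA braid_mul1 braid_mulr1.

(* A sequence $(e_p,\dots,e_1)$ is encoded by the list [:: e_1; ...; e_p], and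
   expo e k is $e_k$, for 1 <= k <= p. *)
Definition expo (e : seq nat) (k : nat) : nat := nth 0 e k.-1.

Definition word_of (e : seq nat) : word :=
  flatten [seq nseq (expo e k) (sigma k) | k <- rev (iota 1 (size e))].

Definition is_block_decomposition (w : word) (e : seq nat) : Prop :=
  word_of e = w /\ forall e' : seq nat, word_of e' = w -> size e <= size e'.

Definition blocks (w : word) : seq nat :=
  xget [::] [set e | is_block_decomposition w e].

Definition emin (k : nat) : nat :=
  if k == 1 then 0 else if k == 2 then 1 else 2.

Definition phi_normal (w : word) : Prop :=
  w <> [::] /\ forall k, 1 <= k < size (blocks w) -> emin k <= expo (blocks w) k.

(* For b <> 1 there is exactly one such word; normal_word 1 is irrelevant. *)
Definition normal_word (b : B3plus) : word :=
  xget [::] [set w | phi_normal w /\ braid w = b].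

Definition exponent_sequence (b : B3plus) : seq nat := blocks (normal_word b).

Definition breadth (b : B3plus) : nat := size (exponent_sequence b).

Definition critical_position (b : B3plus) : nat :=
  let e := exponent_sequence b in
  let p := breadth b in
  head p [seq r <- iota 1 p.-1 | emin r < expo e r].

(* The exponents of the (possibly no longer minimal) expression of w{t}. The
   second case can only occur for r >= 2, since k >= 1. *)
Definition modified_exponents (e : seq nat) (r t : nat) : seq nat :=
  [seq (if k == r then expo e k - 1
        else if k.+1 == r then expo e k + t
        else expo e k) | k <- iota 1 (size e)].

(* b{t}. The operation is meaningful for b <> 1 only; setting 1{t} = 1 lets a
   sequence that has stopped stay at 1. *)
Definition G3_op (b : B3plus) (t : nat) : B3plus :=
  if b == 1%g then 1%g
  else braid (word_of
         (modified_exponents (exponent_sequence b) (critical_position b) t)).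

(* $b_t = b\{1\}\{2\}\cdots\{t\}$ *)
Fixpoint G3_seq (b : B3plus) (t : nat) : B3plus :=
  if t is t'.+1 then G3_op (G3_seq b t') t else b.

(* Main.v *)
Require Import Defs.
From mathcomp Require Import all_boot.
From mathcomp Require Import boolp classical_sets.
From mathcomp Require Import zify.
From Stdlib Require Import Relation_Operators.

Set Implicit Arguments.
Unset Strict Implicit.
Unset Printing Implicit Defensive.

(** Two things are needed: that the operation never leaves the normal words, and
    that it decreases a well-founded order.

    Let (e_p, ..., e_1) be the exponent sequence of b, and r its critical
    position. Taking one letter from block r and adding t >= 1 letters to block
    r - 1 keeps every e_k with k < p at least emin k: this is clear for k <> r,
    and for k = r < p it is the choice of r. So the new word is again normal,
    except that its top block may have become empty. In that case the block is
    dropped: what remains is empty, or normal of breadth p - 1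
    ([modified_exponents_spec]). In all cases the exponent sequence, read from
    e_p down to e_1, decreases for the order that compares first the breadths
    and then, lexicographically, the exponents. However large t is, this holds,
    because the added letters land to the right of the exponent that
    decreases. This order is well-founded ([shortlex_ind]), so the sequence
    stops.

    The argument follows words, whereas the operation is defined on braids,
    through the normal word of the braid. It therefore relies on the normal word
    being unique: otherwise the representative chosen for b{t} could differ from
    w{t}. Uniqueness is obtained by letting the braid monoid act on exponent
    sequences. Left multiplication by a letter sends the normal sequence of a
    braid to another explicit normal sequence ([mul_letter]), and these maps
    satisfy the braid relation ([mul_letter_braid]). Hence applying the letters
    of a word one by one to the sequence of the trivial braid yields a sequence
    that depends only on the braid ([normal_form_eqv]), and for a normal word it
    gives back the exponents of the word ([normal_formK]). The formulas for the
    action come from true identities between braids ([braid_mul_letter]), which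
    gives the existence of normal words as well.

    The action operates on the top block, so sequences are written below with
    the top exponent first, as e_p :: ... :: e_1; they are the reversals of the
    lists e_1 :: ... :: e_p of the definitions. *)

(** * Words and their blocks *)

Arguments sigma : simpl never.

Fixpoint top_word (t : seq nat) : word :=
  if t is x :: s then nseq x (sigma (size t)) ++ top_word s else [::].

Lemma word_of_rcons e x :
  word_of (rcons e x) = nseq x (sigma (size e).+1) ++ word_of e.
Proof.
rewrite /word_of size_rcons -[X in iota _ X]addn1 iotaD rev_cat /= add1n /expo /=.
rewrite nth_rcons ltnn eqxx; congr (_ ++ flatten _).
apply/eq_in_map => k; rewrite mem_rev mem_iota => ke; congr nseq.
by rewrite nth_rcons; have -> : k.-1 < size e by lia.
Qed.

Lemma word_of_rev t : word_of (rev t) = top_word t.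
Proof.
by elim: t => //= x s IH; rewrite rev_cons word_of_rcons size_rev IH.
Qed.

Lemma sigmaS k : sigma k.+1 = ~~ sigma k. Proof. by []. Qed.

Lemma sigmaS_neq k : (sigma k.+1 == sigma k) = false.
Proof. by rewrite sigmaS; case: (sigma k). Qed.

Lemma letter_sigma c k : c = sigma k \/ c = sigma k.+1.
Proof. by rewrite sigmaS; case: c; case: (sigma k); auto. Qed.

Definition incr_top (t : seq nat) : seq nat :=
  if t is x :: s then x.+1 :: s else [::].

(** Adds a letter on the left of a word given by its block exponents. *)
Definition push (c : letter) (t : seq nat) : seq nat :=
  if c == sigma (size t) then incr_top t else 1 :: t.

Lemma push_top x s : push (sigma (size s).+1) (x :: s) = x.+1 :: s.
Proof. by rewrite /push eqxx. Qed.

Lemma push_new s : push (sigma (size s).+1) s = 1 :: s.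
Proof. by rewrite /push sigmaS_neq. Qed.

(** The seed [:: 0] is an empty block 1, which remains empty for the words whose
    last letter is sigma_2. *)
Definition block_exponents (w : word) : seq nat := foldr push [:: 0] w.

Lemma foldr_nseq (A B : Type) (f : A -> B -> B) z n a :
  foldr f z (nseq n a) = iter n (f a) z.
Proof. by elim: n => //= n ->. Qed.

Lemma iter_incr_top (f : seq nat -> seq nat) s x n :
    (forall y, f (y :: s) = y.+1 :: s) ->
  iter n f (x :: s) = (n + x) :: s.
Proof. by move=> fS; elim: n => //= n ->; rewrite fS. Qed.

Lemma size_push_gt0 c t : 0 < size t -> 0 < size (push c t).
Proof. by case: t => // x s _; rewrite /push; case: eqP. Qed.

Lemma size_block_exponents_gt0 w : 0 < size (block_exponents w).
Proof. by elim: w => //= c w; apply: size_push_gt0. Qed.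

Lemma top_word_push c t : 0 < size t -> top_word (push c t) = c :: top_word t.
Proof.
case: t => // x s _; rewrite /push.
by have [->|->] := letter_sigma c (size (x :: s)); rewrite ?eqxx ?sigmaS_neq.
Qed.

Lemma block_exponentsK w : top_word (block_exponents w) = w.
Proof.
by elim: w => //= c w IH; rewrite top_word_push ?size_block_exponents_gt0 ?IH.
Qed.

Lemma head_block_exponents w : w <> [::] -> 0 < head 0 (block_exponents w).
Proof.
case: w => //= c w _; rewrite /push.
by case: eqP (size_block_exponents_gt0 w) => //; case: (block_exponents w).
Qed.

(** Repeating one letter opens at most one block, and none if the top block
    already consists of that letter. *)
Lemma size_iter_push c n t :
  size (iter n (push c) t) <= size t + (c != sigma (size t)).
Proof.
elim: n t => [t|n IH t]; first exact: leq_addr.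
rewrite iterSr; apply: leq_trans (IH _) _; rewrite /push.
have [->|->] := letter_sigma c (size t).
  by rewrite eqxx; case: t => // x s; rewrite eqxx.
by rewrite sigmaS_neq /= eqxx addn0 addn1.
Qed.

(** This says that block_exponents computes the unique shortest expression.
    If t has at least two blocks and its top block is empty, or its other blocks
    are not a shortest expression, then t is strictly longer than the result,
    because adding the letters of the top block opens at most one block. *)
Lemma block_exponents_min t : 0 < size t ->
  let k := block_exponents (top_word t) in
  size k <= size t /\ (size k = size t -> k = t).
Proof.
elim: t => [//|x [|y s] IH _] /=.
  rewrite cats0 /block_exponents foldr_nseq.
  by rewrite (iter_incr_top _ _ (push_top^~ [::])) addn0.
rewrite /block_exponents foldr_cat foldr_nseq -/(block_exponents _).
case: IH => // IHle IHeq.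
set k := block_exponents _ in IHle IHeq *.
case: x => [|x]; first by split=> [|sz]; [exact: leqW | move: IHle; rewrite sz ltnn].
have [ks|ks] := eqVneq (size k) (size (y :: s)).
  rewrite (IHeq ks) iterSr (push_new (y :: s)).
  by rewrite (iter_incr_top _ _ (push_top^~ (y :: s))) addn1.
have kn := size_iter_push (sigma (size s).+2) x.+1 k.
have kl : size k < size (y :: s) by rewrite ltn_neqAle ks.
have {kn} kl' : size (iter x.+1 (push (sigma (size s).+2)) k) <= (size s).+1.
  by apply: leq_trans kn _; move: kl => /=; case: (_ != _); lia.
by split=> [|sz]; [exact: leqW | move: kl'; rewrite sz ltnn].
Qed.

Lemma blocksE w : w <> [::] -> blocks w = rev (block_exponents w).
Proof.
move=> w0; have min e : word_of e = w ->
    size (block_exponents w) <= size e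
    /\ (size (block_exponents w) = size e -> block_exponents w = rev e).
  rewrite -(revK e) word_of_rev size_rev revK => tw.
  by rewrite -tw; apply: block_exponents_min; case: (rev e) tw w0 => [<-|].
have bd : is_block_decomposition w (rev (block_exponents w)).
  split; first by rewrite word_of_rev block_exponentsK.
  by move=> e /min[]; rewrite size_rev.
rewrite /blocks; case: xgetP => [e _ [we emin_]|/(_ _ bd)//].
have [le eqe] := min e we.
rewrite eqe ?revK //; apply/eqP; rewrite eqn_leq le /=.
by rewrite -(size_rev (block_exponents w)); apply: emin_; case: bd.
Qed.

(** * Exponent sequences of normal words *)

(** The condition that the top block must satisfy for another block to be put
    above it in a normal word. *)
Definition full (t : seq nat) : bool := emin (size t) <= head 0 t.

(** The normal sequences, to which [:: 0] is added as the sequence of the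
    trivial braid: this gives the action below a domain containing every braid. *)
Fixpoint regular (t : seq nat) : bool :=
  if t is x :: s then
    if s is [::] then true else [&& 0 < x, full s & regular s]
  else false.

Lemma regular_cons x y s :
  regular (x :: y :: s) = [&& 0 < x, full (y :: s) & regular (y :: s)].
Proof. by []. Qed.

Definition normal_exponents (e : seq nat) : Prop :=
  [/\ 0 < size e, 0 < expo e (size e)
    & forall k, 1 <= k < size e -> emin k <= expo e k].

Lemma expo_rev_cons x s k :
  0 < k <= size s -> expo (rev (x :: s)) k = expo (rev s) k.
Proof.
move=> ks; rewrite /expo rev_cons nth_rcons size_rev.
by have -> : k.-1 < size s by lia.
Qed.

Lemma expo_rev_top t : expo (rev t) (size t) = head 0 t.
Proof.
by case: t => // x s; rewrite /expo rev_cons nth_rcons size_rev /= ltnn eqxx.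
Qed.

Lemma normal_exponents_rev t :
  normal_exponents (rev t) <-> regular t /\ 0 < head 0 t.
Proof.
rewrite /normal_exponents size_rev expo_rev_top.
suff regE : 0 < head 0 t -> (regular t <-> 0 < size t /\
    forall k, 1 <= k < size t -> emin k <= expo (rev t) k).
  by split=> [[t0 h0 te]|[rt h0]]; have [r1 r2] := regE h0;
    [split; auto | case: (r1 rt); split].
elim: t => [|x [|y s] IH] /= h0; first by [].
  by split=> // _; split=> // k; lia.
set u := y :: s in IH *; rewrite h0 /=.
have fullE : full u = (emin (size u) <= expo (rev (x :: u)) (size u)).
  by rewrite expo_rev_cons ?expo_rev_top //= leqnn.
(* Both e_2 and the exponents above it have a positive lower bound. *)
have pos : full u -> 1 < size u -> 0 < head 0 u.
  by rewrite /full /emin /u; case: (s) => [|z [|z' s']] //= /ltnW.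
have regu : full u -> (regular u <-> forall k, 1 <= k < size u ->
    emin k <= expo (rev u) k).
  move=> fu; have [su|su] := leqP (size u) 1.
    by rewrite /u in su *; case: (s) su => //= _; split=> // _ k; lia.
  have [r1 r2] := IH (pos fu su); split=> [/r1[]//|H]; exact: r2.
split=> [/andP[fu ru]|[_ H]].
  split=> // k /andP[k1]; rewrite ltnS leq_eqVlt => /orP[/eqP->|ku].
    by rewrite -fullE.
  rewrite expo_rev_cons; last by rewrite /=; lia.
  by apply: (proj1 (regu fu)) => //; rewrite k1.
have fu : full u by rewrite fullE; apply: H; rewrite /=; lia.
rewrite fu; apply/(regu fu) => k /andP[k1 ku].
by rewrite -(expo_rev_cons x); [apply: H | ]; rewrite /u /= in ku *; lia.
Qed.

(** Shared by push and by left multiplication in the braid monoid, which differ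
    only above a block that is not full; this never occurs while the word of a
    regular sequence is read. *)
Lemma foldr_top_word (f : letter -> seq nat -> seq nat) :
    (forall x s, f (sigma (size s).+1) (x :: s) = x.+1 :: s) ->
    (forall s, regular s -> full s -> f (sigma (size s).+1) s = 1 :: s) ->
  forall t, regular t -> foldr f [:: 0] (top_word t) = t.
Proof.
move=> fS f1; elim=> [//|x [|y s] IH] rt.
  by rewrite /= cats0 foldr_nseq (iter_incr_top _ _ (fS^~ [::])) addn0.
move: rt; rewrite regular_cons => /and3P[x0 fs rs].
rewrite [top_word _]/= foldr_cat foldr_nseq (IH rs).
case: x x0 => // x _; rewrite iterSr (f1 _ rs fs).
by rewrite (iter_incr_top _ _ (fS^~ (y :: s))) addn1.
Qed.

Lemma top_wordK t : regular t -> block_exponents (top_word t) = t.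
Proof.
apply: foldr_top_word => [x s|s _ _]; [exact: push_top | exact: push_new].
Qed.

(** * The action of the letters on normal sequences *)

(** Left multiplication by Delta = sigma_1 sigma_2 sigma_1. Since Delta
    exchanges the two letters when it is moved across them, it can travel to the
    right, the block numbers increasing by one, until the last two blocks, where
    sigma_1^x Delta sigma_1^y = sigma_1^(x+1) sigma_2 sigma_1^(y+1). *)
Fixpoint mul_delta (t : seq nat) : seq nat :=
  if t is x :: s then
    if s is [:: y] then [:: x.+1; 1; y.+1] else x :: mul_delta s
  else [::].

(** Let a be the letter of the top block, and c the other one. If the top block
    is not full, it is a single a above a block c^x with x >= 1. Then
    c a c^x = Delta c^(x-1), and Delta is absorbed by the remaining blocks. *)
Definition mul_letter (c : letter) (t : seq nat) : seq nat :=
  if c == sigma (size t) then incr_top t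
  else if full t then 1 :: t
  else if t is _ :: x :: s then mul_delta (x.-1 :: s) else t.

Definition normal_form (w : word) : seq nat := foldr mul_letter [:: 0] w.

Lemma not_full t : regular t -> ~~ full t ->
  exists x y s, t = [:: 1, x, y & s].
Proof.
case: t => [|x [|y [|z s]]] //; first by case: x.
by rewrite /full /emin /=; case: x => [|[|x]] //; exists y, z, s.
Qed.

Lemma size_mul_delta x y s : size (mul_delta [:: x, y & s]) = (size s).+3.
Proof. by elim: s x y => [//|z s IH] x y /=; rewrite -(IH y z). Qed.

Lemma incr_mul_delta x y s :
  incr_top (mul_delta [:: x, y & s]) = mul_delta [:: x.+1, y & s].
Proof. by case: s. Qed.

Lemma full_mul_delta x y s :
  full [:: x, y & s] -> full (mul_delta [:: x, y & s]).
Proof.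
by rewrite /full size_mul_delta /emin; case: s => [|z s] /=; case: x => [|[|x]].
Qed.

(** Moving a block up by one position requires more of it only from position 2
    to position 3, where its exponent is raised by one. The hypothesis on x leaves
    out the case of two blocks, since their top exponent is raised too. *)
Lemma regular_mul_delta x y s :
    regular (y :: s) -> full (y :: s) -> (s != [::] -> 0 < x) ->
  regular (mul_delta [:: x, y & s]).
Proof.
elim: s x y => [//|z s IH] x y ryz fyz /(_ isT) x0.
move: ryz; rewrite regular_cons => /and3P[y0 fz rz].
have sz := size_mul_delta y z s.
have -> : mul_delta [:: x, y, z & s] = x :: mul_delta [:: y, z & s] by [].
have := full_mul_delta fyz; have := IH y z rz fz (fun=> y0).
by case: (mul_delta _) sz => // u v _ rv fv; rewrite regular_cons x0 fv.
Qed.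

Lemma mul_letter_top c t : c = sigma (size t) -> mul_letter c t = incr_top t.
Proof. by rewrite /mul_letter => ->; rewrite eqxx. Qed.

Lemma mul_letter_full s : full s -> mul_letter (sigma (size s).+1) s = 1 :: s.
Proof. by rewrite /mul_letter sigmaS_neq => ->. Qed.

Lemma mul_letter_slide x y s :
  mul_letter (sigma (size s)) [:: 1, x, y & s] = mul_delta [:: x.-1, y & s].
Proof. by rewrite /mul_letter !sigmaS negbK; case: (sigma _). Qed.

Lemma regular_mul_letter c t : regular t -> regular (mul_letter c t).
Proof.
move=> rt; have [->|->] := letter_sigma c (size t).
  rewrite mul_letter_top //; case: t rt => // x s.
  by case: s => // y s; rewrite !regular_cons => /and3P[_ -> ->].
have [ft|nft] := boolP (full t).
  by rewrite mul_letter_full //; case: t rt ft => // x s rt ft; rewrite regular_cons ft.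
have [x [y [s ts]]] := not_full rt nft; move: rt.
rewrite ts [size _]/= !sigmaS !negbK mul_letter_slide.
rewrite !regular_cons => /and4P[_ fx x0 /andP[fy ry]].
by apply: regular_mul_delta => //; case: s fx {ts fy ry}; case: x x0 => [|[|]].
Qed.

Lemma regular_normal_form w : regular (normal_form w).
Proof. by elim: w => //= c w; apply: regular_mul_letter. Qed.

(** Both sides are the action of Delta. If t has at least two blocks, each of them
    is mul_delta t, the top block being full or not; if t is the single block x,
    each of them is [:: 1; 1; x.+1]. *)
Lemma mul_letter_braid c t : regular t ->
  mul_letter c (mul_letter (~~ c) (mul_letter c t)) =
  mul_letter (~~ c) (mul_letter c (mul_letter (~~ c) t)).
Proof.
move=> rt; wlog -> : c / c = sigma (size t).
  move=> H; have [->|->] := letter_sigma c (size t); first exact: H.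
  by rewrite sigmaS negbK; symmetry; apply: H.
rewrite -!sigmaS.
have [ft|nft] := boolP (full t).
  case: t rt ft => [//|x s] _ ft.
  have ft' : full (x.+1 :: s) by move: ft; rewrite /full /= => /leqW.
  rewrite (@mul_letter_top _ (x :: s)) // (mul_letter_full ft) (mul_letter_full ft').
  case: s ft ft' => [|y s] ft _; first by [].
  have x0 : 0 < x by move: ft; rewrite /full /emin; case: x; case: s.
  rewrite [size _]/= !sigmaS !negbK !mul_letter_slide.
  rewrite [RHS]mul_letter_top ?size_mul_delta ?sigmaS ?negbK //.
  by rewrite incr_mul_delta prednK.
have [x [y [s ts]]] := not_full rt nft; move: rt.
rewrite (@mul_letter_top _ t) // ts [incr_top _]/= [size _]/= !regular_cons.
move=> /and4P[_ fx x0 /andP[fy ry]].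
have f2 : full [:: 2, x, y & s] by [].
rewrite (mul_letter_full f2) [size _]/= !sigmaS !negbK mul_letter_slide.
rewrite -sigmaS (@mul_letter_slide 2 x (y :: s)).
rewrite (@mul_letter_top _ (mul_delta _)) ?size_mul_delta ?sigmaS ?negbK //.
rewrite incr_mul_delta prednK //.
have -> : mul_delta [:: 2.-1, x, y & s] = 1 :: mul_delta [:: x, y & s] by [].
rewrite -(mul_letter_full (full_mul_delta fx)) size_mul_delta.
by rewrite !sigmaS !negbK.
Qed.

Lemma normal_form_eqv u v : braid_eqv u v -> normal_form u = normal_form v.
Proof.
elim=> {u v} [_ _ [u v]|//|u v _ ->//|u v w _ -> _ ->//].
rewrite /normal_form !foldr_cat; congr foldr.
exact: mul_letter_braid (regular_normal_form v).
Qed.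

Lemma normal_formK t : regular t -> normal_form (top_word t) = t.
Proof.
apply: foldr_top_word => [x s|s _]; [exact: mul_letter_top | exact: mul_letter_full].
Qed.

(** * The action computes products of braids *)

Local Open Scope group_scope.

Definition gen (c : letter) : B3plus := braid [:: c].

Definition Delta : B3plus := gen true * gen false * gen true.

Lemma braid_cat u v : braid (u ++ v) = braid u * braid v.
Proof. by rewrite -braid_mulE. Qed.

Lemma braid_cons c w : braid (c :: w) = gen c * braid w.
Proof. exact: (braid_cat [:: c]). Qed.

Lemma braid_nseq n c : braid (nseq n c) = gen c ^+ n.
Proof. by elim: n => [//|n IH]; rewrite braid_cons IH expgS. Qed.

Lemma DeltaE c : Delta = gen c * gen (~~ c) * gen c.
Proof.
case: c => //; rewrite /Delta /gen -!braid_cat.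
by apply/braidP/rst_step; apply: (BraidStep [::] [::]).
Qed.

Lemma Delta_gen c : Delta * gen c = gen (~~ c) * Delta.
Proof. by rewrite {1}(DeltaE (~~ c)) negbK (DeltaE c) !mulgA. Qed.

Lemma Delta_genX c n : Delta * gen c ^+ n = gen (~~ c) ^+ n * Delta.
Proof.
elim: n => [|n IH]; first by rewrite mulg1 mul1g.
by rewrite !expgS mulgA Delta_gen -(mulgA _ Delta) IH mulgA.
Qed.

Lemma braid_top_cons x s :
  braid (top_word (x :: s)) = gen (sigma (size s).+1) ^+ x * braid (top_word s).
Proof. by rewrite braid_cat braid_nseq. Qed.

Lemma braid_mul_delta x y s :
  braid (top_word (mul_delta [:: x, y & s])) =
  Delta * braid (top_word [:: x, y & s]).
Proof.
elim: s x y => [|z s IH] x y.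
  rewrite !braid_top_cons /= !mulg1.
  by rewrite [RHS]mulgA Delta_genX expgSr (expgS _ y) !mulgA.
have -> : mul_delta [:: x, y, z & s] = x :: mul_delta [:: y, z & s] by [].
rewrite braid_top_cons IH size_mul_delta [in RHS]braid_top_cons.
by rewrite mulgA [RHS]mulgA Delta_genX [size _]/= !sigmaS !negbK.
Qed.

Lemma braid_mul_letter c t : regular t ->
  braid (top_word (mul_letter c t)) = gen c * braid (top_word t).
Proof.
move=> rt; have [->|->] := letter_sigma c (size t).
  rewrite mul_letter_top //; case: t rt => // x s _.
  by rewrite !braid_top_cons expgS mulgA.
have [ft|nft] := boolP (full t).
  by rewrite mul_letter_full // braid_top_cons expg1.
have [x [y [s ts]]] := not_full rt nft; move: rt.
rewrite ts [size _]/= !sigmaS !negbK mul_letter_slide.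
rewrite regular_cons => /and3P[_ _]; rewrite regular_cons => /and3P[x0 _ _].
rewrite braid_mul_delta (DeltaE (sigma (size s))) !braid_top_cons.
rewrite /= !sigmaS !negbK expg1 -[in RHS](prednK x0) expgS !mulgA.
by [].
Qed.

Lemma braid_normal_form w : braid (top_word (normal_form w)) = braid w.
Proof.
by elim: w => [//|c w IH]; rewrite braid_mul_letter ?regular_normal_form // IH braid_cons.
Qed.

Local Close Scope group_scope.

(** * Existence and uniqueness of normal words *)

Lemma normal_exponents_word e : normal_exponents e -> word_of e <> [::].
Proof.
rewrite -(revK e) word_of_rev => /normal_exponents_rev[].
by case: (rev e) => // -[].
Qed.

Lemma normal_exponents_inj e e' : normal_exponents e -> normal_exponents e' ->
  braid (word_of e) = braid (word_of e') -> e = e'.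
Proof.
rewrite -(revK e) -(revK e') !word_of_rev => /normal_exponents_rev[re _].
move=> /normal_exponents_rev[re' _] /braidP/normal_form_eqv.
by rewrite !normal_formK // => ->.
Qed.

Lemma normal_exponents_ex b : b <> 1%g ->
  exists2 e, normal_exponents e & b = braid (word_of e).
Proof.
move=> b1; exists (rev (normal_form (repr b))); last first.
  by rewrite word_of_rev braid_normal_form braid_surj.
apply/normal_exponents_rev; split; first exact: regular_normal_form.
have := regular_normal_form (repr b).
case tE: (normal_form (repr b)) => [//|x [|y s]]; last by case/andP.
case: x tE => // tE; case: b1.
by rewrite -(braid_surj b) -braid_normal_form tE.
Qed.

Lemma blocks_word_of e : normal_exponents e -> blocks (word_of e) = e.
Proof.
move=> ne; rewrite blocksE; last exact: normal_exponents_word.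
move: ne.
rewrite -(revK e) word_of_rev => /normal_exponents_rev[re _].
by rewrite top_wordK.
Qed.

Lemma phi_normalP w :
  phi_normal w <-> exists2 e, normal_exponents e & w = word_of e.
Proof.
split=> [[w0 wn]|[e ne ->]]; last first.
  split; first exact: normal_exponents_word.
  by rewrite blocks_word_of //; case: ne.
have bE := blocksE w0.
exists (blocks w); last by rewrite bE word_of_rev block_exponentsK.
split=> //; rewrite bE size_rev ?size_block_exponents_gt0 //.
by rewrite expo_rev_top head_block_exponents.
Qed.

Lemma exponent_sequenceE e : normal_exponents e ->
  exponent_sequence (braid (word_of e)) = e.
Proof.
move=> ne; rewrite /exponent_sequence /normal_word.
case: xgetP => [w _ [/phi_normalP[e' ne' ->] /normal_exponents_inj ee']|].
  by rewrite blocks_word_of // ee'.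
by move=> /(_ (word_of e))[]; split=> //; apply/phi_normalP; exists e.
Qed.

(** These properties of r are what makes the operation preserve normality: the
    rth block can lose a letter, unless it is the top block. *)
Lemma critical_position_spec e : normal_exponents e ->
  let r := critical_position (braid (word_of e)) in
  1 <= r <= size e /\ (r < size e -> emin r < expo e r).
Proof.
move=> ne; have [e0 _ _] := ne.
rewrite /critical_position /breadth exponent_sequenceE //=.
case sE: [seq r <- _ | _] => [|r s] /=; first by rewrite e0 leqnn ltnn.
have : r \in [seq r <- iota 1 (size e).-1 | emin r < expo e r].
  by rewrite sE mem_head.
rewrite mem_filter mem_iota => /and3P[er r1 re].
by split=> //; lia.
Qed.

(** * The descent *)

Definition lexlt (s t : seq nat) : Prop :=
  exists2 i, i < size t &
    nth 0 s i < nth 0 t i /\ forall j, j < i -> nth 0 s j = nth 0 t j.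

Definition shortlex (s t : seq nat) : Prop :=
  size s < size t \/ size s = size t /\ lexlt s t.

(** The length has to be fixed: the lexicographic order on lists of arbitrary
    length is not well-founded. *)
Lemma lexlt_ind n (P : seq nat -> Prop) :
    (forall t, size t = n ->
       (forall s, size s = n -> lexlt s t -> P s) -> P t) ->
  forall t, size t = n -> P t.
Proof.
elim: n P => [|n IHn] P step t.
  by move=> t0; apply: step => // s _ []; rewrite t0.
case: t => // x t [tn]; elim/ltn_ind: x t tn => x IHx.
apply: (IHn (fun t => P (x :: t))) => t tn IHt.
apply: step => [|[//|y s] [sn] [[|i] /= it [lt eqs]]]; first by rewrite /= tn.
  exact: IHx.
have /= -> := eqs 0 (ltn0Sn i); apply: IHt => //; exists i => //; split=> // j ji.
exact: (eqs j.+1).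
Qed.

Lemma shortlex_ind (P : seq nat -> Prop) :
  (forall t, (forall s, shortlex s t -> P s) -> P t) -> forall t, P t.
Proof.
move=> step t; have [n] := ubnP (size t); elim: n t => // n IHn t /ltnSE.
rewrite leq_eqVlt => /orP[/eqP|]; last exact: IHn.
apply: lexlt_ind t => t tn IHt; apply: step => s [|[st lt]].
  by rewrite tn; apply: IHn.
by apply: IHt => //; rewrite st.
Qed.

Lemma size_modified e r k : size (modified_exponents e r k) = size e.
Proof. by rewrite size_map size_iota. Qed.

Lemma expo_modified e r t k : 1 <= k <= size e ->
  expo (modified_exponents e r t) k =
  if k == r then expo e k - 1
  else if k.+1 == r then expo e k + t else expo e k.
Proof.
case: k => // k /= ke; rewrite {1}/expo (nth_map 0) ?size_iota //.
by rewrite nth_iota // add1n.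
Qed.

Lemma nth_rev_expo e i : i < size e -> nth 0 (rev e) i = expo e (size e - i).
Proof. by move=> ie; rewrite nth_rev // /expo subnS. Qed.

(** The hypothesis 0 < t matters when the block that disappears is the second one:
    block 1, which may have been empty, then becomes the top block. *)
Lemma modified_exponents_spec e r t :
    normal_exponents e -> 1 <= r <= size e ->
    (r < size e -> emin r < expo e r) -> 0 < t ->
  let e' := modified_exponents e r t in
  word_of e' = [::] \/
  exists2 e'', normal_exponents e'' /\ word_of e'' = word_of e' &
    shortlex (rev e'') (rev e).
Proof.
move=> [e0 etop emid] /andP[r1 re] rmin t0 e'.
have e's : size e' = size e by apply: size_modified.
have e'E k := @expo_modified e r t k; rewrite -/e' in e'E.
have er : 0 < expo e r.
  by move: re; rewrite leq_eqVlt => /orP[/eqP->//|/rmin]; apply: leq_trans.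
have e'mid k : 1 <= k < size e -> emin k <= expo e' k.
  move=> /andP[k1 ke]; rewrite e'E; last by rewrite k1 ltnW.
  case: eqP => [kr|_]; first by move: rmin; rewrite -kr ke => /(_ isT); lia.
  have := emid k; rewrite k1 ke => /(_ isT) ek.
  by case: eqP => // _; apply: leq_trans ek (leq_addr _ _).
have [e'top|] := posnP (expo e' (size e)); last first.
  move=> e'top; right; exists e'.
    by split=> //; split; rewrite ?e's.
  right; rewrite !size_rev e's; split=> //.
  exists (size e - r); first by rewrite size_rev; lia.
  rewrite !nth_rev_expo ?e's; try lia.
  rewrite subKn // e'E ?r1 // eqxx; split=> [|j jr]; first by lia.
  rewrite !nth_rev_expo ?e's; try lia.
  by rewrite e'E; [case: eqP => [|_]; [lia | case: eqP => //; lia] | lia].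
(* The top block has been emptied: it was critical and had a single letter. *)
move: e's e'E e'mid e'top; case/lastP: e' => [|s x].
  by move=> /esym/eqP; rewrite gtn_eqF.
rewrite size_rcons => ss e'E e'mid e'top.
have x0 : x = 0 by move: e'top; rewrite /expo -ss /= nth_rcons ltnn eqxx.
have sE k : 1 <= k <= size s -> expo (rcons s x) k = expo s k.
  by move=> ks; rewrite /expo nth_rcons; have -> : k.-1 < size s by lia.
have rE : r = size e.
  have := e'E (size e); rewrite e'top leqnn e0 => /(_ isT).
  by case: eqP => // _; case: eqP; lia.
rewrite word_of_rcons x0 /=.
have [s0|s0] := posnP (size s); first by left; rewrite (size0nil s0).
right; exists s; last by left; rewrite !size_rev -ss.
split=> //; split=> // [|k /andP[k1 ks]].
  rewrite -sE ?s0 //= e'E; last by lia.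
  rewrite rE -ss eqxx; case: eqP => [|_]; first by lia.
  by lia.
by rewrite -sE ?k1 ?(ltnW ks) //; apply: e'mid; lia.
Qed.

Lemma G3_op_spec e t : normal_exponents e -> 0 < t ->
  G3_op (braid (word_of e)) t = 1%g \/
  exists2 e', normal_exponents e' /\ G3_op (braid (word_of e)) t = braid (word_of e')
    & shortlex (rev e') (rev e).
Proof.
move=> ne t0; rewrite /G3_op; case: eqP => [|_]; first by left.
have [rb rmin] := critical_position_spec ne.
rewrite exponent_sequenceE //.
have [->|[e' [ne' <-] lt]] := modified_exponents_spec ne rb rmin t0.
  by left.
by right; exists e'.
Qed.

Theorem propositionA (b : B3plus) : exists t : nat, G3_seq b t = 1%g.
Proof.
have [b1|/eqP/normal_exponents_ex[e ne be]] := eqVneq b 1%g; first by exists 0.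
(* The time n has to vary in the induction, since the sequence is not started
   again at time 0 from the smaller braid. *)
suff H t n e' : rev e' = t -> normal_exponents e' ->
    G3_seq b n = braid (word_of e') -> exists m, G3_seq b m = 1%g.
  exact: (H _ 0 e).
elim/shortlex_ind: t n e' => t IH n e' te ne' bn.
have [b1|[e'' [ne'' be''] lt]] := G3_op_spec ne' (ltn0Sn n).
  by exists n.+1; rewrite /= bn.
by apply: (IH (rev e'') _ n.+1 e'') => //=; rewrite -?te ?bn.
Qed.
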